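(* There exists $c>0$, and for every $\varepsilon>0$ there exists $c_1>0$, such that the following holds for every sufficiently large $n$. Let $G$ be a $d$-regular graph on $n$ vertices with $d\geq 1$, and let $\lambda_2$ denote the second largest eigenvalue of the adjacency matrix of $G$. Then $$\lambda_2>\begin{cases} c\,d^{1/2} &\text{if } d\leq n^{2/3},\\ c\, n/d & \text{if } n^{2/3}\leq d\leq n^{3/4},\\ c_1\,d^{1/3} & \text{if } n^{3/4}\leq d\leq (1/2-\varepsilon)n.\end{cases}$$ *)

(* Defs.v *)
From HB Require Import structures.
From mathcomp Require Import all_boot all_order all_algebra complex.
From mathcomp Require Import all_classical all_reals all_analysis.

Set Implicit Arguments.
Unset Strict Implicit.
Unset Printing Implicit Defensive.

Import Order.TTheory GRing.Theory Num.Theory.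
Local Open Scope ring_scope.

Record sgraph (V : finType) := SGraph {
  adj :> rel V;
  adj_sym : symmetric adj;
  adj_irr : irreflexive adj }.

Definition regular (V : finType) (G : sgraph V) (d : nat) : Prop :=
  forall v : V, #|[set w | G v w]| = d.

Definition adjmx (R : realType) (V : finType) (G : sgraph V) : 'M[R]_#|V| :=
  \matrix_(i, j) (G (enum_val i) (enum_val j))%:R.

(* The eigenvalues listed in nonincreasing order, repeated according to their
   multiplicity in the characteristic polynomial. The list is unique when it
   exists, and it exists for every symmetric matrix (eigenvaluesP below); the
   default value [::] is only reached when char_poly A does not split over R. *)
Definition eigenvalues (R : realType) (n : nat) (A : 'M[R]_n) : seq R :=
  xget [::] [set s : seq R |
    sorted >=%R s /\ char_poly A = \prod_(x <- s) ('X - x%:P)]%classic.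

Definition lambda2 (R : realType) (V : finType) (G : sgraph V) : R :=
  nth 0 (eigenvalues (adjmx R G)) 1.

Lemma char_poly_conj (F : fieldType) (n : nat) (P A : 'M[F]_n) :
  P \in unitmx -> char_poly (invmx P *m A *m P) = char_poly A.
Proof.
move=> uP; rewrite /char_poly.
have -> : char_poly_mx (invmx P *m A *m P) =
  map_mx polyC (invmx P) *m char_poly_mx A *m map_mx polyC P.
  rewrite /char_poly_mx mulmxBr mulmxBl !map_mxM; congr (_ - _).
  rewrite mul_mx_scalar -scalemxAl -map_mxM mulVmx // map_scalar_mx.
  by rewrite scale_scalar_mx mulr1.
rewrite !det_mulmx mulrAC -det_mulmx -map_mxM mulVmx // map_scalar_mx.
by rewrite det1 mul1r.
Qed.

Lemma char_poly_splits (R : realType) (n : nat) (A : 'M[R]_n) :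
  A^T = A -> exists s : seq R, char_poly A = \prod_(x <- s) ('X - x%:P).
Proof.
move=> symA; pose B := map_mx (real_complex R) A.
have hB : B \is hermsymmx.
  apply: realsym_hermsym.
    apply/is_hermitianmxP.
    by rewrite expr0 scale1r map_mx_id // /B map_trmx symA.
  by apply/mxOverP => i j; rewrite mxE complex_real.
have /orthomx_spectralP EB := hermitian_normalmx hB.
have /mxOverP hr := hermitian_spectral_diag_real hB.
pose D := spectral_diag B.
have cB : char_poly B = \prod_i ('X - (D 0 i)%:P).
  rewrite EB char_poly_conj ?spectral_unit //.
  rewrite char_poly_trig; last exact: diag_mx_is_trig.
  by apply: eq_bigr => i _; rewrite mxE eqxx mulr1n.
exists [seq complex.Re (D 0 i) | i <- enum 'I_n].
apply: (@map_poly_inj _ _ (real_complex R)).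
rewrite map_char_poly cB big_map rmorph_prod big_enum /=.
apply: eq_bigr => i _; rewrite rmorphB /= map_polyX map_polyC /=.
by rewrite RRe_real ?hr.
Qed.

Lemma eigenvaluesP (R : realType) (n : nat) (A : 'M[R]_n) : A^T = A ->
  sorted >=%R (eigenvalues A) /\
  char_poly A = \prod_(x <- eigenvalues A) ('X - x%:P).
Proof.
move=> /char_poly_splits[s As].
apply: (@xgetPex _ [::] (fun s : seq R =>
  sorted >=%R s /\ char_poly A = \prod_(x <- s) ('X - x%:P))).
exists (sort >=%R s); split; first by apply: sort_sorted => x y; exact: le_total.
by rewrite As; apply: perm_big; rewrite perm_sym perm_sort.
Qed.

Lemma tr_adjmx (R : realType) (V : finType) (G : sgraph V) :
  (adjmx R G)^T = adjmx R G.
Proof. by apply/matrixP => i j; rewrite !mxE adj_sym. Qed.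

(* Main.v *)
Require Import Defs.
From mathcomp Require Import all_boot all_order all_algebra all_fingroup.
From mathcomp Require Import complex.
From mathcomp Require Import all_classical all_reals all_analysis.
From mathcomp Require Import ring lra.

(** Suppose that lambda_2 <= lam < d and let M = lam I - A + p J, where
  p = (d - lam) / n. The all-ones vector is an eigenvector of A for d, and every
  other eigenvalue is at most lam, so M is positive semidefinite, that is,
  M = B B^T for some B. Cauchy-Schwarz for the entries of B and M B reads
  (tr M^2)^2 <= tr M tr M^3; as M J = 0, tr A = 0, tr A^2 = nd and tr A^3 >= 0,
  it gives
    (n lam^2 + nd - (d - lam)^2)^2
      <= (n lam + d - lam) (n lam^3 + 3 lam nd + (d - lam)^3),
  which fails when lam is a small multiple of min(d^(1/2), n/d) and d is at most
  n / 10. By Schur's product theorem the entrywise cube of M is positive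
  semidefinite too, so its entries have a nonnegative sum, which forces
  (lam + p)^3 >= d (1 - p) (1 - 2 p); the right-hand side is of order d when
  d <= (1/2 - eps) n. *)

Set Implicit Arguments.
Unset Strict Implicit.
Unset Printing Implicit Defensive.

Import Order.TTheory GRing.Theory Num.Theory.
Local Open Scope ring_scope.

Section CauchySchwarz.
Variable R : realDomainType.

Lemma sqr_sum_mul_le (I : finType) (x y : I -> R) :
  (\sum_i x i * y i) ^+ 2 <= (\sum_i x i ^+ 2) * (\sum_i y i ^+ 2).
Proof.
rewrite -(ler_pMn2r (isT : (0 < 2)%N)) -subr_ge0.
have -> : (\sum_i x i ^+ 2) * (\sum_i y i ^+ 2) *+ 2 -
    (\sum_i x i * y i) ^+ 2 *+ 2 =
    \sum_i \sum_j (x i * y j - x j * y i) ^+ 2.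
  rewrite mulr2n {2}[(\sum_i x i ^+ 2) * _]mulrC expr2 !big_distrlr /=.
  rewrite -sumrMnl -big_split -sumrB /=.
  apply: eq_bigr => i _; rewrite -sumrMnl -big_split -sumrB /=.
  by apply: eq_bigr => j _; ring.
by do 2![apply: sumr_ge0 => ? _]; rewrite sqr_ge0.
Qed.

Lemma sqr_mxtrace_mul_tr_le m n (A B : 'M[R]_(m, n)) :
  \tr (A *m B^T) ^+ 2 <= \tr (A *m A^T) * \tr (B *m B^T).
Proof.
have trE (X Y : 'M[R]_(m, n)) : \tr (X *m Y^T) = \sum_p X p.1 p.2 * Y p.1 p.2.
  rewrite -(pair_bigA _ (fun i j => X i j * Y i j)) /=.
  apply: eq_bigr => i _; rewrite mxE.
  by apply: eq_bigr => j _; rewrite mxE.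
by rewrite !trE; exact: sqr_sum_mul_le.
Qed.

End CauchySchwarz.

(* Over the reals these are exactly the positive semidefinite matrices. *)
Definition gram_mx (R : pzRingType) n (A : 'M[R]_n) : Prop :=
  exists m (B : 'M[R]_(n, m)), A = B *m B^T.

Section GramMatrix.
Variables (R : realDomainType) (n : nat).
Implicit Types A B : 'M[R]_n.

Lemma gram_mxtrace_ge0 A : gram_mx A -> 0 <= \tr A.
Proof.
case=> m [B ->]; apply: sumr_ge0 => i _; rewrite mxE; apply: sumr_ge0 => k _.
by rewrite mxE -expr2 sqr_ge0.
Qed.

Lemma gram_mxtrace_sqr_le A :
  gram_mx A -> \tr (A *m A) ^+ 2 <= \tr A * \tr (A *m A *m A).
Proof.
case=> m [B AE]; have trA : A^T = A by rewrite AE trmx_mul trmxK.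
have := sqr_mxtrace_mul_tr_le B (A *m B).
by rewrite trmx_mul trA !mulmxA -AE -[A *m B *m _]mulmxA -AE.
Qed.

Lemma gram_sum_ge0 A : gram_mx A -> 0 <= \sum_i \sum_j A i j.
Proof.
case=> m [B ->].
suff -> : \sum_i \sum_j (B *m B^T) i j = \sum_k (\sum_i B i k) ^+ 2.
  by apply: sumr_ge0 => k _; exact: sqr_ge0.
under eq_bigr do under eq_bigr do rewrite mxE.
under eq_bigr do rewrite exchange_big.
rewrite exchange_big; apply: eq_bigr => k _; rewrite expr2 big_distrlr /=.
by do 2![apply: eq_bigr => ? _]; rewrite mxE.
Qed.

End GramMatrix.

Section SchurProduct.
Variables (R : comPzRingType) (n : nat).
Implicit Types A B : 'M[R]_n.

(* Schur's product theorem: if A and B are the Gram matrices of vectors a_i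
   and b_i, their entrywise product is that of the tensors a_i (x) b_i. *)
Lemma gram_map2_mul A B :
  gram_mx A -> gram_mx B -> gram_mx (map2_mx *%R A B).
Proof.
move=> [m [U ->]] [p [W ->]].
exists (m * p)%N, (\matrix_i mxvec ((row i U)^T *m row i W)).
apply/matrixP => i j; rewrite !mxE.
transitivity ((mxvec ((row i U)^T *m row i W) *m
  (mxvec ((row j U)^T *m row j W))^T) 0 0).
  rewrite mxvec_dotmul mulmxA -mulmxA mxE big_ord1 !mxE.
  by congr (_ * _); apply: eq_bigr => k _; rewrite !mxE // mulrC.
by rewrite mxE; apply: eq_bigr => k _; rewrite !mxE.
Qed.

Lemma gram_map_exp A k :
  gram_mx A -> gram_mx (map_mx (fun x => x ^+ k.+1) A).
Proof.
move=> gramA; elim: k => [|k IHk].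
  by rewrite (_ : map_mx _ A = A) //; apply/matrixP => i j; rewrite mxE.
rewrite (_ : map_mx _ A = map2_mx *%R A (map_mx (fun x => x ^+ k.+1) A)).
  exact: gram_map2_mul.
by apply/matrixP => i j; rewrite !mxE exprS.
Qed.

End SchurProduct.

Section ComplexGram.
Variable R : rcfType.
Local Open Scope sesquilinear_scope.
Local Notation toC := (real_complex R).

Lemma gram_mx_of_complex m n (A : 'M[R]_n) (B : 'M[R[i]]_(n, m)) :
  map_mx toC A = B *m B ^t* -> gram_mx A.
Proof.
move=> AE; exists (m + m)%N.
exists (row_mx (map_mx (@complex.Re R) B) (map_mx (@complex.Im R) B)).
rewrite tr_row_mx mul_row_col; apply/matrixP => i j.
have /matrixP/(_ i j) := AE; rewrite [LHS]mxE.
move=> /(congr1 (@complex.Re R)) /= ->.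
rewrite !mxE raddf_sum -big_split /=; apply: eq_bigr => k _; rewrite !mxE.
by case: (B i k) (B j k) => [a b] [c d] /=; rewrite mulrN opprK.
Qed.

Lemma gram_mx_of_diag m n (A : 'M[R]_n) (P : 'M[R[i]]_(m, n)) (mu : 'rV_m) :
  (forall k, 0 <= mu 0 k) -> map_mx toC A = P ^t* *m diag_mx mu *m P ->
  gram_mx A.
Proof.
move=> mu_ge0 AE.
apply: (@gram_mx_of_complex m _ _ (P ^t* *m diag_mx (map_mx sqrtC mu))).
rewrite AE trmx_mul map_mxM /= trmxCK tr_diag_mx map_diag_mx !mulmxA.
rewrite -[_ *m diag_mx _ *m diag_mx _]mulmxA mulmx_diag.
congr (_ *m diag_mx _ *m _).
by apply/rowP => k; rewrite !mxE /= geC0_conj ?sqrtC_ge0 // -expr2 sqrtCK.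
Qed.

End ComplexGram.

Section UnitaryDiagonalization.
Variables (C : numClosedFieldType) (n : nat) (P : 'M[C]_n) (v : 'cV[C]_n).
Local Open Scope sesquilinear_scope.
Hypothesis unitaryP : P \is unitarymx.

Lemma eigenvector_coord_eq0 (A : 'M[C]_n) (D : 'rV[C]_n) a k :
  A = P ^t* *m diag_mx D *m P -> A *m v = a *: v -> D 0 k != a ->
  (P *m v) k 0 = 0.
Proof.
move=> ->; rewrite -!mulmxA => eig_v; apply: contra_neq_eq => Pv_k.
move: eig_v => /(congr1 (mulmx P)); rewrite mulmxA (unitarymxP unitaryP) mul1mx.
rewrite -scalemxAr; move: Pv_k; move: (P *m v) => w w_k.
by rewrite mul_diag_mx => /colP/(_ k); rewrite !mxE => /(mulIf w_k).
Qed.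

Lemma sqr_norm_unitary_mul :
  \sum_k `|(P *m v) k 0| ^+ 2 = \sum_k `|v k 0| ^+ 2.
Proof.
have sqr_normE (w : 'cV[C]_n) : \sum_k `|w k 0| ^+ 2 = (w ^t* *m w) 0 0.
  by rewrite mxE; apply: eq_bigr => k _; rewrite !mxE normCKC.
rewrite !sqr_normE trmx_mul map_mxM /= mulmxA.
by rewrite mulmxKtV.
Qed.

End UnitaryDiagonalization.

Section RealSymmetric.
Variable R : realType.
Local Open Scope sesquilinear_scope.
Local Notation toC := (real_complex R).

Lemma size_eigenvalues n (A : 'M[R]_n) : A^T = A -> size (eigenvalues A) = n.
Proof.
move=> /eigenvaluesP[_ /(congr1 (fun p : {poly R} => size p))].
by rewrite size_char_poly size_prod_XsubC => -[].
Qed.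

Lemma eigenvalues_nonincreasing n (A : 'M[R]_n) i j : A^T = A ->
  (i <= j < n)%N -> (eigenvalues A)`_j <= (eigenvalues A)`_i.
Proof.
move=> symA /andP[ij jn]; have [srt _] := eigenvaluesP symA.
have ge_trans : transitive (>=%R : rel R) by move=> x y z xy /le_trans; apply.
apply: (sorted_leq_nth ge_trans (fun=> lexx _) _ srt) => //;
  by rewrite inE size_eigenvalues // (leq_ltn_trans ij).
Qed.

Lemma perm_eigenvalues_diag n (A : 'M[R]_n) (P : 'M[R[i]]_n) (D : 'rV_n) :
  A^T = A -> P \in unitmx -> map_mx toC A = invmx P *m diag_mx D *m P ->
  perm_eq [tuple D 0 k | k < n] (map toC (eigenvalues A)).
Proof.
move=> symA unitP AE; apply: prod_XsubC_eq.
transitivity (\prod_k ('X - (D 0 k)%:P)).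
  by rewrite big_tuple; apply: eq_bigr => k _; rewrite tnth_mktuple.
rewrite big_map.
have [_ charA] := eigenvaluesP symA.
transitivity (map_poly toC (char_poly A)); last first.
  rewrite charA rmorph_prod; apply: eq_bigr => x _.
  by rewrite rmorphB /= map_polyX map_polyC.
rewrite map_char_poly AE char_poly_conj // char_poly_trig ?diag_mx_is_trig //.
by apply: eq_bigr => k _; rewrite mxE eqxx mulr1n.
Qed.

Lemma symmetric_spectral n (A : 'M[R]_n) : A^T = A ->
  exists2 P : 'M[R[i]]_n, P \is unitarymx &
    map_mx toC A = P ^t* *m diag_mx (\row_k toC (eigenvalues A)`_k) *m P.
Proof.
move=> symA; pose B := map_mx toC A.
have normalB : B \is normalmx.
  apply: symmetric_normalmx.
    apply/is_hermitianmxP.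
    by rewrite expr0 scale1r map_mx_id // /B map_trmx symA.
  by apply/mxOverP => i j; rewrite mxE complex_real.
have /orthomx_spectralP BE := normalB.
have unitaryQ := spectral_unitarymx B; set Q := spectralmx B in BE unitaryQ.
set D := spectral_diag B in BE.
have prm := perm_eigenvalues_diag symA (unitarymx_unit unitaryQ) BE.
have sz : size (map toC (eigenvalues A)) == n.
  by rewrite size_map size_eigenvalues.
have /tuple_permP[s DE] : perm_eq [tuple D 0 k | k < n] (Tuple sz) by [].
have {}DE k : D 0 k = toC (eigenvalues A)`_(s k).
  have /(congr1 (fun t => tnth t k)) := val_inj DE.
  by rewrite !tnth_mktuple (tnth_nth 0) /= (nth_map 0) // size_eigenvalues.
exists (perm_mx s^-1 *m Q).
  apply: mul_unitarymx => //; apply/unitarymxP.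
  by rewrite tr_perm_mx map_perm_mx invgK -perm_mxM mulVg perm_mx1.
rewrite -/B {1}BE invmx_unitary // trmx_mul map_mxM /= tr_perm_mx map_perm_mx.
rewrite invgK !mulmxA; congr (_ *m _); rewrite -!mulmxA; congr (_ *m _).
rewrite -row_permE -col_permE; apply/matrixP => i j; rewrite !mxE.
by rewrite DE (inj_eq perm_inj).
Qed.

Section Deflation.
Variables (n : nat) (A : 'M[R]_n) (u : 'cV[R]_n) (a : R) (P : 'M[R[i]]_n).
Hypotheses (symA : A^T = A) (Au : A *m u = a *: u).
Hypothesis eig1_lt : (eigenvalues A)`_1 < a.
Hypothesis unitaryP : P \is unitarymx.
Hypothesis AE :
  map_mx toC A = P ^t* *m diag_mx (\row_k toC (eigenvalues A)`_k) *m P.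
Local Notation w := (P *m map_mx toC u).

Lemma eigenvalue_of_coord_neq0 k : w k 0 != 0 -> (eigenvalues A)`_k = a.
Proof.
apply: contra_neq_eq => e_k.
apply: (eigenvector_coord_eq0 (a := toC a) unitaryP AE).
  by rewrite -map_mxM Au map_mxZ.
by rewrite mxE (inj_eq (fmorph_inj toC)).
Qed.

Lemma top_eigenvector_coord_eq0 (k : 'I_n) : (0 < k)%N -> w k 0 = 0.
Proof.
move=> k_gt0; apply/eqP; apply: contraT => /eigenvalue_of_coord_neq0 e_k.
have : (eigenvalues A)`_k <= (eigenvalues A)`_1.
  by rewrite eigenvalues_nonincreasing // k_gt0 ltn_ord.
by rewrite e_k leNgt eig1_lt.
Qed.

Lemma sqr_norm_top_eigenvector_coord (k : 'I_n) :
  k = 0%N :> nat -> `|w k 0| ^+ 2 = toC (\sum_i u i 0 ^+ 2).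
Proof.
move=> k0; transitivity (\sum_j `|w j 0| ^+ 2).
  rewrite (bigD1 k) //= big1 ?addr0 // => j jk.
  by rewrite top_eigenvector_coord_eq0 ?normr0 ?expr0n //= lt0n -k0.
rewrite sqr_norm_unitary_mul // rmorph_sum; apply: eq_bigr => i _.
by rewrite mxE sqr_normc conjc_real -rmorphM expr2.
Qed.

Lemma top_eigenvector_outer :
  w *m w ^t* = diag_mx (\row_k `|w k 0| ^+ 2).
Proof.
move: top_eigenvector_coord_eq0; move: (w) => w' w_eq0.
apply/matrixP => i j; rewrite !mxE big_ord1 !mxE.
have [->|ij] := eqVneq i j; first by rewrite mulr1n -normCK.
have [i0|/w_eq0->] := posnP i; last by rewrite mulr0n mul0r.
by rewrite (w_eq0 j) ?conjC0 ?mulr0 // lt0n -i0 eq_sym.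
Qed.

Lemma deflation_diag lam c :
  map_mx toC (lam%:M - A + c *: (u *m u^T)) =
  P ^t* *m diag_mx (\row_k (toC (lam - (eigenvalues A)`_k)
                            + toC c * `|w k 0| ^+ 2)) *m P.
Proof.
have PtP : P ^t* *m P = 1%:M by rewrite -invmx_unitary ?mulVmx ?unitarymx_unit.
have uE : map_mx toC u = P ^t* *m w by rewrite mulmxA PtP mul1mx.
have uuE : map_mx toC (u *m u^T) = P ^t* *m (w *m w ^t* ) *m P.
  rewrite map_mxM {1}uE !mulmxA -[RHS]mulmxA; congr (_ *m _).
  rewrite trmx_mul map_mxM /= -mulmxA PtP mulmx1.
  by apply/matrixP => i j; rewrite !mxE; exact/esym/conjc_real.
have rowE : \row_k (toC (lam - (eigenvalues A)`_k) + toC c * `|w k 0| ^+ 2) =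
    const_mx (toC lam) - \row_k toC (eigenvalues A)`_k +
    toC c *: \row_k `|w k 0| ^+ 2.
  by apply/rowP => k; rewrite !mxE rmorphB.
rewrite map_mxD map_mxB map_mxZ map_scalar_mx uuE top_eigenvector_outer rowE.
rewrite linearD linearB linearZ /= diag_const_mx.
rewrite mulmxDr mulmxBr mulmxDl mulmxBl.
by rewrite -AE mul_mx_scalar -scalemxAl PtP scalemx1 -scalemxAr -scalemxAl.
Qed.

End Deflation.

(* The rank-one term only affects the component along u, where it replaces the
   negative eigenvalue lam - a by zero. *)
Lemma gram_deflation n (A : 'M[R]_n) (u : 'cV_n) (a lam : R) :
  A^T = A -> A *m u = a *: u -> u != 0 -> (eigenvalues A)`_1 <= lam < a ->
  gram_mx (lam%:M - A + ((a - lam) / \sum_i u i 0 ^+ 2) *: (u *m u^T)).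
Proof.
move=> symA Au u_neq0 /andP[lam_ge lam_lt].
have eig1_lt := le_lt_trans lam_ge lam_lt.
have [P unitaryP AE] := symmetric_spectral symA.
apply: gram_mx_of_diag (deflation_diag symA Au eig1_lt unitaryP AE _ _) => k.
rewrite mxE; have [k0|k_gt0] := posnP k; last first.
  rewrite (top_eigenvector_coord_eq0 symA Au) // normr0 expr0n mulr0 addr0 /=.
  rewrite ler0c subr_ge0; apply: le_trans lam_ge.
  by rewrite eigenvalues_nonincreasing // k_gt0 ltn_ord.
have norm_w := sqr_norm_top_eigenvector_coord symA Au eig1_lt unitaryP AE k0.
have sqr_norm_neq0 : \sum_i u i 0 ^+ 2 != 0.
  apply: contra_neq u_neq0 => /psumr_eq0P u_eq0; apply/colP => i; apply/eqP.
  by rewrite mxE -sqrf_eq0 u_eq0 // => j _; exact: sqr_ge0.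
rewrite norm_w -rmorphM divfK // -rmorphD /=.
rewrite (eigenvalue_of_coord_neq0 Au unitaryP AE).
  by rewrite addrA subrK subrr.
by rewrite -normr_eq0 -sqrf_eq0 norm_w fmorph_eq0.
Qed.

End RealSymmetric.

Lemma mxtrace_const (R : pzSemiRingType) n (a : R) :
  \tr (const_mx a : 'M[R]_n) = n%:R * a.
Proof.
rewrite /mxtrace; under eq_bigr do rewrite mxE.
by rewrite sumr_const card_ord mulr_natl.
Qed.

Section ScalarShift.
Variables (R : comPzRingType) (n : nat) (A : 'M[R]_n) (x : R).

Lemma mxtrace_scalar_sub_sqr :
  \tr ((x%:M - A) *m (x%:M - A)) = n%:R * x ^+ 2 - 2 * x * \tr A + \tr (A *m A).
Proof.
rewrite mulmxBl !mulmxBr -scalar_mxM mul_scalar_mx mul_mx_scalar.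
rewrite !linearB /= mxtrace_scalar mxtraceZ -mulr_natl; ring.
Qed.

Lemma mxtrace_scalar_sub_cube :
  \tr ((x%:M - A) *m (x%:M - A) *m (x%:M - A)) =
  n%:R * x ^+ 3 - 3 * x ^+ 2 * \tr A + 3 * x * \tr (A *m A) - \tr (A *m A *m A).
Proof.
rewrite mulmxBr mul_mx_scalar linearB /= mxtraceZ mxtrace_scalar_sub_sqr.
rewrite mulmxBl !mulmxBr -scalar_mxM mul_scalar_mx mul_mx_scalar !mulmxBl.
rewrite mul_scalar_mx -!scalemxAl !linearB /= !mxtraceZ; ring.
Qed.

End ScalarShift.

Section RegularGraph.
Variables (R : realType) (V : finType) (G : sgraph V) (d : nat).
Hypothesis regG : regular G d.
Local Notation N := (#|V|%:R : R).
Local Notation D := (d%:R : R).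
Local Notation A := (adjmx R G).

Lemma sum_adjmx_row i : \sum_j A i j = D.
Proof.
under eq_bigr do rewrite mxE.
rewrite -(regG (enum_val i)) -sum1_card natr_sum.
rewrite -(big_enum_val (fun v => (G (enum_val i) v)%:R : R)) /=.
rewrite [RHS]big_mkcond; apply: eq_bigr => v _.
by rewrite inE; case: (G _ v).
Qed.

Lemma adjmx_mul_const1 n : A *m const_mx 1 = D *: const_mx 1 :> 'M[R]_(#|V|, n).
Proof.
apply/matrixP => i j; rewrite !mxE mulr1 -(sum_adjmx_row i).
by apply: eq_bigr => k _; rewrite [const_mx _ _ _]mxE mulr1.
Qed.

Lemma mxtrace_adjmx : \tr A = 0.
Proof. by rewrite /mxtrace big1 // => i _; rewrite mxE adj_irr. Qed.

Lemma mxtrace_adjmx2 : \tr (A *m A) = N * D.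
Proof.
transitivity (\sum_(i < #|V|) D); last first.
  by rewrite sumr_const card_ord mulr_natl.
apply: eq_bigr => i _; rewrite -(sum_adjmx_row i) mxE; apply: eq_bigr => j _.
by rewrite !mxE [G (enum_val j) _]adj_sym -natrM mulnb andbb.
Qed.

Lemma mxtrace_adjmx3_ge0 : 0 <= \tr (A *m A *m A).
Proof.
apply: sumr_ge0 => i _; rewrite mxE; apply: sumr_ge0 => j _.
rewrite mulr_ge0 //; last by rewrite mxE.
by rewrite mxE; apply: sumr_ge0 => k _; rewrite !mxE -natrM.
Qed.

Variable lam : R.
Local Notation p := ((D - lam) / N).
Local Notation L := (lam%:M - A).
Local Notation J := (const_mx 1 : 'M[R]_#|V|).

Definition deflated_adjmx : 'M[R]_#|V| := L + p *: J.
Local Notation M := deflated_adjmx.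

Hypothesis V_gt0 : (0 < #|V|)%N.

Lemma gram_deflated_adjmx : lambda2 R G <= lam -> lam < D -> gram_mx M.
Proof.
move=> lambda2_le lam_lt.
have lam_between : (eigenvalues A)`_1 <= lam < D by rewrite lambda2_le.
have u_neq0 : const_mx 1 != 0 :> 'cV[R]_#|V|.
  by apply/eqP => /colP/(_ (Ordinal V_gt0))/eqP; rewrite !mxE oner_eq0.
have := gram_deflation (tr_adjmx R G) (adjmx_mul_const1 1) u_neq0 lam_between.
under eq_bigr do rewrite mxE expr1n; rewrite sumr_const card_ord trmx_const.
suff -> : (const_mx 1 : 'cV[R]_#|V|) *m const_mx 1 = J by [].
by apply/matrixP => i j; rewrite !mxE big_ord1 !mxE mulr1.
Qed.

Lemma mul_scalar_sub_adjmx_const1 : L *m J = (lam - D) *: J.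
Proof. by rewrite mulmxBl mul_scalar_mx adjmx_mul_const1 -scalerBl. Qed.

Lemma mul_deflated_adjmx_const1 : M *m J = 0.
Proof.
have JJ : J *m J = N *: J.
  apply/matrixP => i j; rewrite !mxE.
  by under eq_bigr do rewrite !mxE mulr1; rewrite sumr_const card_ord mulr1.
rewrite mulmxDl mul_scalar_sub_adjmx_const1 -scalemxAl JJ scalerA.
by rewrite divfK ?pnatr_eq0 -?lt0n // -scalerDl addrA subrK subrr scale0r.
Qed.

Lemma mulmx_deflated_adjmx : M *m M = M *m L.
Proof.
rewrite [X in _ *m X = _]/M mulmxDr -scalemxAr mul_deflated_adjmx_const1.
by rewrite scaler0 addr0.
Qed.

Lemma mxtrace_deflated_adjmx : \tr M = N * lam + (D - lam).
Proof.
rewrite linearD linearB /= mxtrace_scalar mxtrace_adjmx subr0.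
by rewrite mxtraceZ mxtrace_const mulr1 divfK ?pnatr_eq0 -?lt0n // mulr_natl.
Qed.

Lemma mxtrace_sqr_deflated_adjmx :
  \tr (M *m M) = N * lam ^+ 2 + N * D - (D - lam) ^+ 2.
Proof.
rewrite mulmx_deflated_adjmx mulmxDl linearD /= -scalemxAl mxtraceZ.
rewrite [\tr (J *m _)]mxtrace_mulC mul_scalar_sub_adjmx_const1 mxtraceZ.
rewrite mxtrace_const mulr1 mxtrace_scalar_sub_sqr mxtrace_adjmx mxtrace_adjmx2.
by field; rewrite pnatr_eq0 -lt0n.
Qed.

Lemma mxtrace_cube_deflated_adjmx_le :
  \tr (M *m M *m M) <= N * lam ^+ 3 + 3 * lam * (N * D) + (D - lam) ^+ 3.
Proof.
rewrite -mulmxA mulmx_deflated_adjmx mulmxA mulmx_deflated_adjmx.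
rewrite mulmxDl mulmxDl linearD /= -!scalemxAl mxtraceZ.
rewrite [\tr (J *m L *m _)]mxtrace_mulC mulmxA [\tr (L *m J *m _)]mxtrace_mulC.
rewrite mul_scalar_sub_adjmx_const1 -scalemxAr mul_scalar_sub_adjmx_const1.
rewrite scalerA mxtraceZ mxtrace_const mulr1 mxtrace_scalar_sub_cube.
rewrite mxtrace_adjmx mxtrace_adjmx2.
rewrite -subr_ge0 [leRHS](_ : _ = \tr (A *m A *m A)) ?mxtrace_adjmx3_ge0 //.
by field; rewrite pnatr_eq0 -lt0n.
Qed.

Lemma deflated_adjmx_trace_ineq : lambda2 R G <= lam -> lam < D ->
  (N * lam ^+ 2 + N * D - (D - lam) ^+ 2) ^+ 2 <=
  (N * lam + (D - lam)) * (N * lam ^+ 3 + 3 * lam * (N * D) + (D - lam) ^+ 3).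
Proof.
move=> lambda2_le lam_lt; have gramM := gram_deflated_adjmx lambda2_le lam_lt.
rewrite -mxtrace_sqr_deflated_adjmx -mxtrace_deflated_adjmx.
apply: le_trans (gram_mxtrace_sqr_le gramM) _.
by rewrite ler_wpM2l ?gram_mxtrace_ge0 ?mxtrace_cube_deflated_adjmx_le.
Qed.

Lemma sum_cube_deflated_adjmx_row i :
  \sum_j M i j ^+ 3 = (lam + p) ^+ 3 - D * (1 - p) ^+ 3 + (N - D - 1) * p ^+ 3.
Proof.
rewrite (eq_bigr (fun j => p ^+ 3 + A i j * ((p - 1) ^+ 3 - p ^+ 3) +
    ((lam + p) ^+ 3 - p ^+ 3) *+ (j == i))); last first.
  move=> j _; rewrite !mxE [j == i]eq_sym.
  have [->|_] := eqVneq i j; first by rewrite adj_irr /= !mulr1n; ring.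
  by case: (G _ _); rewrite /= ?mulr1n !mulr0n; ring.
rewrite !big_split /= sumr_const card_ord -mulr_suml sum_adjmx_row.
rewrite (bigD1 i) //= eqxx big1; last by move=> j /negPf->.
by rewrite mulr1n -[p ^+ 3 *+ _]mulr_natl; ring.
Qed.

Lemma deflated_adjmx_cubic_bound : lambda2 R G <= lam -> 0 <= lam < D ->
  D * ((1 - p) * (1 - 2 * p)) <= (lam + p) ^+ 3.
Proof.
move=> lambda2_le /andP[lam_ge0 lam_lt].
have N_gt0 : 0 < N by rewrite ltr0n.
have p_ge0 : 0 <= p by rewrite divr_ge0 ?subr_ge0 ?ltW.
have Np : N * p <= D by rewrite mulrC divfK ?gt_eqF // gerBl.
have row_ge0 : 0 <= (lam + p) ^+ 3 - D * (1 - p) ^+ 3 + (N - D - 1) * p ^+ 3.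
  have := gram_sum_ge0 (gram_map_exp 2 (gram_deflated_adjmx lambda2_le lam_lt)).
  under eq_bigr => i _.
    under eq_bigr do rewrite mxE.
    rewrite sum_cube_deflated_adjmx_row; over.
  by rewrite sumr_const card_ord pmulrn_lge0.
have Np3 : N * p * p ^+ 2 <= D * p ^+ 2 by rewrite ler_wpM2r ?sqr_ge0.
have p3_ge0 : 0 <= p ^+ 3 by rewrite exprn_ge0.
have -> : (1 - p) * (1 - 2 * p) = (1 - p) ^+ 3 - p ^+ 2 + p ^+ 3 by ring.
move: row_ge0 Np3 p3_ge0; move: (p) => q; lra.
Qed.

End RegularGraph.

(* In terms of N = #|V| and D = d, the expressions bounded here are tr M, tr M^2
   and the upper bound for tr M^3, where M is deflated_adjmx. *)
Section TraceEstimates.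
Variables (R : realFieldType) (N D lam : R).

Lemma trace_sqr_ge : 1 <= D -> 10 * D <= N -> 0 <= lam ->
  9 / 10 * (N * D) <= N * lam ^+ 2 + N * D - (D - lam) ^+ 2.
Proof.
move=> D_ge1 ND lam_ge0.
have D2_le : 10 * D * D <= N * D by rewrite ler_wpM2r //; lra.
have lamD_ge0 : 0 <= lam * D by rewrite mulr_ge0 //; lra.
have Nlam2_ge0 : 0 <= (N - 1) * lam ^+ 2 by rewrite mulr_ge0 ?sqr_ge0 //; lra.
lra.
Qed.

Lemma trace_mul_trace_cube_le : 0 <= N -> 0 <= lam <= D -> lam ^+ 2 <= D ->
  (N * lam + (D - lam)) * (N * lam ^+ 3 + 3 * lam * (N * D) + (D - lam) ^+ 3) <=
  (N * lam + D) * (4 * (N * lam * D) + D ^+ 3).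
Proof.
move=> N_ge0 /andP[lam_ge0 lam_le] lam2_le.
have Nlam_ge0 : 0 <= N * lam by rewrite mulr_ge0.
apply: ler_pM; [lra | | lra |].
  by rewrite !addr_ge0 ?mulr_ge0 ?exprn_ge0 //; lra.
have lam3_le : N * lam * lam ^+ 2 <= N * lam * D by rewrite ler_wpM2l.
have D3_le : (D - lam) ^+ 3 <= D ^+ 3 by rewrite ler_pXn2r ?nnegrE //; lra.
lra.
Qed.

Lemma trace_mul_trace_cube_lt : 1 <= D -> 10 * D <= N -> 0 <= lam ->
  lam ^+ 2 <= D / 100 -> lam * D <= N / 10 ->
  (N * lam + (D - lam)) * (N * lam ^+ 3 + 3 * lam * (N * D) + (D - lam) ^+ 3) <
  (N * lam ^+ 2 + N * D - (D - lam) ^+ 2) ^+ 2.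
Proof.
move=> D_ge1 ND lam_ge0 lam2_le lamD_le.
have lam_le : lam <= D by nra.
have ND_gt0 : 0 < N * D by rewrite mulr_gt0 //; lra.
apply: le_lt_trans (trace_mul_trace_cube_le _ _ _) _; first by lra.
- by rewrite lam_ge0.
- lra.
apply: lt_le_trans (_ : (9 / 10 * (N * D)) ^+ 2 <= _); last first.
  have sqr_ge := trace_sqr_ge D_ge1 ND lam_ge0.
  by rewrite ler_pXn2r ?nnegrE //; lra.
have N2lam2_le : N ^+ 2 * D * lam ^+ 2 <= N ^+ 2 * D * (D / 100).
  by rewrite ler_wpM2l // mulr_ge0 ?sqr_ge0 //; lra.
have NlamD3_le : N * D ^+ 2 * (lam * D) <= N * D ^+ 2 * (N / 10).
  by rewrite ler_wpM2l // mulr_ge0 ?sqr_ge0 //; lra.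
have NlamD2_le : N * D * (lam * D) <= N * D * (N / 10 * D).
  by rewrite ler_wpM2l ?ltW //; nra.
have D4_le : D ^+ 2 * (10 * D) ^+ 2 <= D ^+ 2 * N ^+ 2.
  by rewrite ler_wpM2l ?sqr_ge0 // ler_pXn2r ?nnegrE //; lra.
have ND2_gt0 : 0 < (N * D) ^+ 2 by rewrite exprn_gt0.
lra.
Qed.

End TraceEstimates.

Lemma mul_le_of_exprS_le (R : realDomainType) (a x y : R) k :
  0 <= a -> 0 <= x -> 0 <= y -> a ^+ k.+1 <= y -> x ^+ k.+1 <= y ^+ k ->
  a * x <= y.
Proof.
move=> a_ge0 x_ge0 y_ge0 ak_le xk_le.
rewrite -(@ler_pXn2r _ k.+1) ?nnegrE ?mulr_ge0 // exprMn [leRHS]exprS.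
by rewrite ler_pM ?exprn_ge0.
Qed.

Section RationalPowers.
Variables (R : realType) (x y : R) (p q : nat).
Hypotheses (x_ge0 : 0 <= x) (y_ge0 : 0 <= y) (q_gt0 : (0 < q)%N).

Lemma exprn_powR_div : (x `^ (p%:R / q%:R)) ^+ q = x ^+ p.
Proof.
rewrite -powR_mulrn ?powR_ge0 // -powRrM divfK ?powR_mulrn //.
by rewrite pnatr_eq0 -lt0n.
Qed.

Lemma le_powR_div : (y <= x `^ (p%:R / q%:R)) = (y ^+ q <= x ^+ p).
Proof. by rewrite -exprn_powR_div ler_pXn2r ?nnegrE ?powR_ge0. Qed.

Lemma powR_div_le : (x `^ (p%:R / q%:R) <= y) = (x ^+ p <= y ^+ q).
Proof. by rewrite -exprn_powR_div ler_pXn2r ?nnegrE ?powR_ge0. Qed.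

End RationalPowers.

Section SecondEigenvalueBounds.
Variables (R : realType) (V : finType) (G : sgraph V) (d : nat).
Hypotheses (regG : regular G d) (d_gt0 : (0 < d)%N).
Local Notation N := (#|V|%:R : R).
Local Notation D := (d%:R : R).

Lemma lambda2_gt_of_trace (lam : R) : 10 * D <= N -> 0 <= lam ->
  lam ^+ 2 <= D / 100 -> lam * D <= N / 10 -> lam < lambda2 R G.
Proof.
move=> ND lam_ge0 lam2_le lamD_le; rewrite ltNge; apply/negP => lambda2_le.
have D_ge1 : 1 <= D by rewrite ler1n.
have V_gt0 : (0 < #|V|)%N by rewrite -(ltr0n R); lra.
have lam_lt : lam < D by nra.
have := deflated_adjmx_trace_ineq regG V_gt0 lambda2_le lam_lt.
by rewrite leNgt trace_mul_trace_cube_lt.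
Qed.

Lemma lambda2_gt_of_cube (eps lam : R) : 0 < eps -> D <= (1 / 2 - eps) * N ->
  0 <= lam -> (lam + 1) ^+ 3 < eps * D -> lam < lambda2 R G.
Proof.
move=> eps_gt0 D_le lam_ge0 cube_lt; rewrite ltNge; apply/negP => lambda2_le.
have D_gt0 : 0 < D by rewrite ltr0n.
have N_gt0 : 0 < N.
  rewrite lt0r ler0n andbT; apply: contraTneq D_le => ->.
  by rewrite mulr0 -ltNge.
have eps_lt : eps < 1 / 2.
  by rewrite -subr_gt0 -(pmulr_lgt0 _ N_gt0) (lt_le_trans D_gt0).
have lam_lt : lam < D.
  have epsD : eps * D <= D by rewrite ler_piMl //; lra.
  have lam2_ge0 := sqr_ge0 lam; have lam3_ge0 := exprn_ge0 3 lam_ge0; lra.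
have V_gt0 : (0 < #|V|)%N by rewrite -(ltr0n R).
have lam_between : 0 <= lam < D by rewrite lam_ge0.
have := deflated_adjmx_cubic_bound regG V_gt0 lambda2_le lam_between.
apply/negP; rewrite -ltNge; set p := (_ - _) / _.
have p_ge0 : 0 <= p by rewrite divr_ge0 ?subr_ge0 ?ltW.
have p_le : p <= 1 / 2 - eps by rewrite ler_pdivrMr //; lra.
apply: (@le_lt_trans _ _ ((lam + 1) ^+ 3)).
  by rewrite ler_pXn2r ?nnegrE //; lra.
apply: lt_le_trans cube_lt _; rewrite mulrC ler_wpM2l ?(ltW D_gt0) //.
have -> : eps = 1 / 2 * (2 * eps) by lra.
by apply: ler_pM; lra.
Qed.

Lemma lambda2_gt_sqrt : 10 ^+ 3 <= N -> D <= N `^ (2 / 3) ->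
  1 / 10 * D `^ (1 / 2) < lambda2 R G.
Proof.
move=> N_ge; rewrite (le_powR_div 2) // => D3_le.
have sqrtD : (D `^ (1 / 2)) ^+ 2 = D by rewrite (exprn_powR_div 1) ?expr1.
have sqrtD_ge0 : 0 <= D `^ (1 / 2) := powR_ge0 _ _.
have DsqrtD_le : D `^ (1 / 2) * D <= N.
  rewrite -(@ler_pXn2r _ 2) ?nnegrE ?mulr_ge0 //.
  by rewrite exprMn sqrtD -exprS.
apply: lambda2_gt_of_trace; rewrite ?exprMn ?sqrtD; [|lra..].
exact: mul_le_of_exprS_le D3_le.
Qed.

Lemma lambda2_gt_div : 10 ^+ 4 <= N -> N `^ (2 / 3) <= D -> D <= N `^ (3 / 4) ->
  1 / 10 * (N / D) < lambda2 R G.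
Proof.
move=> N_ge; rewrite (powR_div_le 2) // (le_powR_div 3) // => D3_ge D4_le.
have D_gt0 : 0 < D by rewrite ltr0n.
apply: lambda2_gt_of_trace => //.
- exact: mul_le_of_exprS_le D4_le.
- rewrite exprMn expr_div_n.
  have : N ^+ 2 / D ^+ 2 <= D by rewrite ler_pdivrMr ?exprn_gt0 // -exprS.
  lra.
- by rewrite -[leLHS]mulrA divfK ?gt_eqF //; lra.
Qed.

Lemma lambda2_gt_cbrt (eps a : R) : 0 < eps -> 0 < a -> 8 * a ^+ 3 < eps ->
  a ^- 4 <= N -> N `^ (3 / 4) <= D -> D <= (1 / 2 - eps) * N ->
  a * D `^ (1 / 3) < lambda2 R G.
Proof.
move=> eps_gt0 a_gt0 a3_lt N_ge; rewrite (powR_div_le 3) // => D4_ge D_le.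
have D_gt0 : 0 < D by rewrite ltr0n.
set t := D `^ _; have t3 : t ^+ 3 = D by rewrite (exprn_powR_div 1) ?expr1.
have t_ge0 : 0 <= t := powR_ge0 _ _.
have a_ge0 := ltW a_gt0.
have at_ge1 : 1 <= a * t.
  rewrite mulrC -ler_pdivrMr // (le_powR_div 1) ?divr_ge0 // expr1.
  rewrite -(@ler_pXn2r _ 4) ?nnegrE ?exprn_ge0 ?divr_ge0 //.
  apply: le_trans D4_ge; rewrite div1r -exprM (exprM _ 4 3) exprVn.
  by rewrite ler_pXn2r ?nnegrE ?invr_ge0 ?exprn_ge0.
apply: lambda2_gt_of_cube eps_gt0 D_le _ _; first by rewrite mulr_ge0.
apply: (@le_lt_trans _ _ ((2 * (a * t)) ^+ 3)).
  by rewrite ler_pXn2r ?nnegrE //; lra.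
have -> : (2 * (a * t)) ^+ 3 = 8 * a ^+ 3 * t ^+ 3 by ring.
by rewrite t3 ltr_pM2r.
Qed.

End SecondEigenvalueBounds.

Theorem theorem1p6 (R : realType) :
  exists c : R, 0 < c /\
  forall eps : R, 0 < eps ->
  exists c1 : R, 0 < c1 /\
  exists n0 : nat, forall n : nat, (n0 <= n)%N ->
  forall (V : finType) (G : sgraph V) (d : nat),
    #|V| = n -> (1 <= d)%N -> regular G d ->
  [/\ (d%:R <= n%:R `^ (2 / 3) :> R ->
         c * d%:R `^ (1 / 2) < lambda2 R G),
      (n%:R `^ (2 / 3) <= d%:R :> R -> d%:R <= n%:R `^ (3 / 4) :> R ->
         c * (n%:R / d%:R) < lambda2 R G)
    & (n%:R `^ (3 / 4) <= d%:R :> R -> d%:R <= (1 / 2 - eps) * n%:R ->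
         c1 * d%:R `^ (1 / 3) < lambda2 R G)].
Proof.
exists (1 / 10); split; first lra.
move=> eps eps_gt0; pose a : R := (eps / 16) `^ (1 / 3).
have a_gt0 : 0 < a by apply: powR_gt0; rewrite divr_gt0.
have a3_lt : 8 * a ^+ 3 < eps.
  by rewrite (exprn_powR_div 1) ?divr_ge0 ?ltW // expr1; lra.
exists a; split=> //; exists (maxn (10 ^ 4) (Num.bound (a ^- 4))) => n.
rewrite geq_max => /andP[n_ge a_le] V G d Vn d_gt0 regG; subst n.
have N_ge : 10 ^+ 4 <= #|V|%:R :> R by rewrite -natrX ler_nat.
have aN_le : a ^- 4 <= #|V|%:R.
  apply: le_trans (ltW (archi_boundP _)) _; last by rewrite ler_nat.
  by rewrite invr_ge0 exprn_ge0 ?ltW.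
split.
- by apply: lambda2_gt_sqrt => //; lra.
- exact: lambda2_gt_div.
- exact: lambda2_gt_cbrt.
Qed.
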